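(* Let $F$ and $K$ be two finite fields such that $|F|\geq 3$ and $|K|\geq 3$. Then $\Gamma(\mathbb{Z}_2\times F\times K)$ is not partitionable into global defensive alliances.
   Context: $\mathbb{Z}_n=\mathbb{Z}/n\mathbb{Z}$. For a commutative ring $R$ with $1\neq 0$, the zero-divisor graph $\Gamma(R)$ is the simple graph whose vertices are the nonzero zero-divisors of $R$, two distinct vertices $x,y$ being adjacent if and only if $xy=0$. Let $\Gamma=(V,E)$ be a finite simple graph. For $S\subseteq V$ put $\bar S=V\setminus S$ and $\deg_S(x)=|S\cap N(x)|$, where $N(x)$ is the set of vertices adjacent to $x$. A nonempty $S\subseteq V$ is a dominating set if $\deg_S(v)>0$ for every $v\in\bar S$; it is a defensive alliance if $\deg_S(x)+1\ge \deg_{\bar S}(x)$ for every $x\in S$; it is a global defensive alliance if it is both. The global defensive alliance partition number $\psi_g(\Gamma)$ is the maximum number of sets in a partition of $V$ such that each set is a global defensive alliance; $\Gamma$ is partitionable into global defensive alliances if $\psi_g(\Gamma)\ge 2$. *)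

(* Defs.v *)
From HB Require Import structures.
From mathcomp Require Import all_boot all_order all_algebra all_field.

Set Implicit Arguments.
Unset Strict Implicit.
Unset Printing Implicit Defensive.

Import GRing.Theory.

(* MathComp has prod instances for finType and comNzRingType, not for their join. *)
HB.instance Definition _ (R S : finComNzRingType) :=
  GRing.ComNzRing.on (R * S)%type.

Record sgraph := SGraph {
  vertex :> finType;
  adj : rel vertex;
  adj_sym : symmetric adj;
  adj_irrefl : irreflexive adj
}.

Section Alliances.
Variable G : sgraph.
Implicit Types (S : {set G}) (x : G).

Definition neighbours x : {set G} := [set y | adj x y].

Definition deg_in S x : nat := #|S :&: neighbours x|.

Definition dominating S : bool :=
  (S != set0) && [forall v in ~: S, 0 < deg_in S v].

Definition defensive_alliance S : bool :=
  (S != set0) && [forall x in S, deg_in (~: S) x <= deg_in S x + 1].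

Definition global_defensive_alliance S : bool :=
  dominating S && defensive_alliance S.

Definition gda_partition (P : {set {set G}}) : bool :=
  partition P [set: G] && [forall S in P, global_defensive_alliance S].

(* The value is 0 when no such partition exists. *)
Definition psi_g : nat := \max_(P : {set {set G}} | gda_partition P) #|P|.

Definition partitionable_gda : Prop := 2 <= psi_g.

End Alliances.

Section ZeroDivisorGraph.
Local Open Scope ring_scope.
Variable R : finComNzRingType.

Definition zero_divisor (x : R) : bool :=
  [exists y : R, (y != 0) && (x * y == 0)].

Definition zdvertex : finType := {x : R | (x != 0) && zero_divisor x}.

Definition zdadj : rel zdvertex :=
  fun x y => (x != y) && (val x * val y == 0).

Lemma zdadj_sym : symmetric zdadj.
Proof. by move=> x y; rewrite /zdadj eq_sym mulrC. Qed.

Lemma zdadj_irrefl : irreflexive zdadj.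
Proof. by move=> x; rewrite /zdadj eqxx. Qed.

Definition zero_divisor_graph : sgraph := SGraph zdadj_sym zdadj_irrefl.

End ZeroDivisorGraph.

(* Main.v *)
(* Write e = (1,0,0).  A vertex (0,a,b) with a, b nonzero has e as its only
   neighbour, so a block T avoiding e contains all of them.  The alliance
   condition at e for the block S containing e then leaves so little room,
   because (|F|-2)(|K|-2) > 0, that S contains every (0,0,b).  But these are all
   the neighbours of (1,1,0), of which there are at least two: T can neither
   dominate (1,1,0) nor defend it. *)
Require Import Defs.
From mathcomp Require Import all_boot all_order all_algebra all_field.
From mathcomp Require Import zify.

Set Implicit Arguments.
Unset Strict Implicit.
Unset Printing Implicit Defensive.

Import GRing.Theory.

(** A maximum of at least 2 forces a partition with two or more blocks: [S] is the block of [x], and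
    [T] is any other one. *)
Lemma partitionable_gdaP (G : sgraph) (x : G) :
  partitionable_gda G ->
  exists S T : {set G},
    [/\ x \in S, [disjoint S & T],
        global_defensive_alliance S & global_defensive_alliance T].
Proof.
rewrite /partitionable_gda /psi_g => psi_ge2.
have [P /andP[partP /forall_inP gdaP] P_gt1] :
    exists2 P : {set {set G}}, gda_partition P & 1 < #|P|.
  apply/exists_inP; apply: contraLR psi_ge2.
  rewrite negb_exists_in => /forall_inP P_le1; rewrite -leqNgt.
  by apply/bigmax_leqP => P /P_le1; rewrite -leqNgt.
have [/eqP coverP trivP _] := and3P partP.
have xP : x \in cover P by rewrite coverP inE.
have SP := pblock_mem xP.
have [T] : exists T, T \in P :\ pblock P x.
  apply/set0Pn; rewrite -card_gt0.
  by move: P_gt1; rewrite (cardsD1 (pblock P x)) SP.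
rewrite !inE => /andP[TS TP].
exists (pblock P x), T; split; rewrite ?mem_pblock ?gdaP //.
by apply: (trivIsetP trivP) => //; rewrite eq_sym.
Qed.

Lemma in_neighbours (G : sgraph) (x y : G) : (y \in neighbours x) = adj x y.
Proof. by rewrite inE. Qed.

Section GlobalDefensiveAlliance.
Variables (G : sgraph) (S : {set G}).
Hypothesis gdaS : global_defensive_alliance S.

Lemma gda_dominates x : x \notin S -> exists2 y, y \in S & adj x y.
Proof.
case/andP: gdaS => /andP[_ /forall_inP domS] _ xS.
have /card_gt0P[y] := domS x (etrans (in_setC _ _) xS).
by rewrite !inE => /andP[yS xy]; exists y.
Qed.

Lemma gda_defends x : x \in S -> deg_in (~: S) x <= deg_in S x + 1.
Proof. by case/andP: gdaS => _ /andP[_ /forall_inP]; apply. Qed.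

End GlobalDefensiveAlliance.

(** * Zero products and vertices in coordinates *)

Section Z2FK.
Variables F K : finFieldType.
Local Notation R := ('Z_2 * F * K)%type.
Local Open Scope ring_scope.

Lemma Z2FK_eq0 (x : R) : (x == 0) = [&& x.1.1 == 0, x.1.2 == 0 & x.2 == 0].
Proof. by case: x => [[z a] b]; rewrite andbA. Qed.

Lemma Z2FK_mul_eq0 (x y : R) :
  (x * y == 0) = [&& (x.1.1 == 0) || (y.1.1 == 0),
    (x.1.2 == 0) || (y.1.2 == 0) & (x.2 == 0) || (y.2 == 0)].
Proof.
rewrite Z2FK_eq0 /= -[X in _ = [&& _, X & _]]mulf_eq0.
rewrite -[X in _ = [&& _, _ & X]]mulf_eq0; congr (_ && _).
(* The field coordinates are settled by [mulf_eq0], the one in ['Z_2] by its four cases. *)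
by move: x.1.1 y.1.1 => [[|[|//]] ?] [[|[|//]] ?].
Qed.

(** The idempotent supported on a vanishing coordinate annihilates [x]. *)
Lemma Z2FK_is_vertex (x : R) :
    x != 0 -> [|| x.1.1 == 0, x.1.2 == 0 | x.2 == 0] ->
  (x != 0) && zero_divisor x.
Proof.
move=> -> /or3P x0; apply/existsP.
case: x0 => x0; [exists (1, 0, 0) | exists (0, 1, 0) | exists (0, 0, 1)];
  by rewrite Z2FK_mul_eq0 Z2FK_eq0 /= x0 !eqxx ?orbT ?oner_eq0.
Qed.

(* The zero-divisor graph is kept abstract, described by its coordinates:
   unfolding its vertex type makes unification of sets of vertices diverge. *)
Section AbstractGraph.
Variables (G : sgraph) (coords : G -> R) (vtx : R -> G).
Hypothesis coordsK : cancel coords vtx.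
Hypothesis coords_neq0 : forall x, coords x != 0.
Hypothesis coords_vtx : forall x : R,
  x != 0 -> [|| x.1.1 == 0, x.1.2 == 0 | x.2 == 0] -> coords (vtx x) = x.
Hypothesis adjE :
  forall x y : G, adj x y = (x != y) && (coords x * coords y == 0).

Definition e : G := vtx (1, 0, 0).
(** The zero triple is not a vertex and [vtx] is unspecified there, which is why the sets below
    range over nonzero entries. *)
Definition vtxF (a : F) : G := vtx (0, a, 0).
Definition vtxK (b : K) : G := vtx (0, 0, b).
Definition vtxFK (u : F * K) : G := vtx (0, u.1, u.2).

Lemma coords_e : coords e = (1, 0, 0).
Proof. by apply: coords_vtx; rewrite ?Z2FK_eq0 /= ?eqxx. Qed.

Lemma coords_vtxF a : a != 0 -> coords (vtxF a) = (0, a, 0).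
Proof. by move=> a0; apply: coords_vtx; rewrite ?Z2FK_eq0 /= ?eqxx // andbT. Qed.

Lemma coords_vtxK b : b != 0 -> coords (vtxK b) = (0, 0, b).
Proof. by move=> b0; apply: coords_vtx; rewrite ?Z2FK_eq0 /= ?eqxx. Qed.

Lemma coords_vtxFK u : u.1 != 0 -> coords (vtxFK u) = (0, u.1, u.2).
Proof.
by move=> a0; apply: coords_vtx; rewrite ?Z2FK_eq0 /= ?eqxx // (negPf a0).
Qed.

Definition setK : {set G} := [set vtxK b | b in [set~ 0]].
Definition setFK : {set G} := [set vtxFK u | u in setX [set~ 0] [set~ 0]].

Lemma card_setK : #|setK| = #|K|.-1.
Proof.
rewrite card_in_imset ?cardsC1 // => b c; rewrite !inE => b0 c0 /(congr1 coords).
by rewrite !coords_vtxK // => -[].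
Qed.

Lemma card_setFK : #|setFK| = (#|F|.-1 * #|K|.-1)%N.
Proof.
rewrite card_in_imset ?cardsX ?cardsC1 // => -[a b] [a' b'].
rewrite !inE => /andP[a0 _] /andP[a0' _] /(congr1 coords).
by rewrite !coords_vtxFK // => -[-> ->].
Qed.

Lemma disjoint_setFK_setK : [disjoint setFK & setK].
Proof.
apply/pred0Pn => -[x /andP[/imsetP[u]]]; rewrite !inE => /andP[a0 _] ->.
case/imsetP=> b; rewrite !inE => b0 /(congr1 coords).
by rewrite coords_vtxFK // coords_vtxK // => -[a_eq0]; rewrite a_eq0 eqxx in a0.
Qed.

(** * Neighbourhoods of [e] and of (1,1,0) *)

Lemma adj_eE (x : G) : adj e x = ((coords x).1.1 == 0).
Proof.
rewrite adjE Z2FK_mul_eq0 coords_e /= !eqxx /= andbT andb_idl //.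
(* Distinctness is automatic: the first coordinate of [e] is 1, not 0. *)
by apply: contraL => /eqP <-; rewrite coords_e.
Qed.

Lemma adj_e_setK (x : G) : x \in setK -> adj e x.
Proof. by case/imsetP=> b; rewrite !inE adj_eE => b0 ->; rewrite coords_vtxK. Qed.

Lemma adj_e_setFK (x : G) : x \in setFK -> adj e x.
Proof.
case/imsetP=> u; rewrite !inE adj_eE => /andP[a0 b0] ->.
by rewrite coords_vtxFK.
Qed.

(** Both field coordinates of [x] are nonzero, so those of [y] vanish; as [y] is nonzero, its
    coordinate in ['Z_2] must be 1. *)
Lemma adj_setFK (x y : G) : x \in setFK -> adj x y -> y = e.
Proof.
case/imsetP=> u; rewrite !inE => /andP[a0 b0] ->.
rewrite adjE Z2FK_mul_eq0 coords_vtxFK //= (negPf a0) (negPf b0) /=.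
case/and3P=> _ /eqP y2 /eqP y3; apply: (can_inj coordsK); rewrite coords_e.
have y0 := coords_neq0 y.
move: y2 y3 y0; rewrite Z2FK_eq0; case: (coords y) => [[z a] b] /= -> ->.
rewrite !eqxx !andbT => z0; congr (_, _, _).
by case: z z0 => [[|[|//]] ?] // _; apply: val_inj.
Qed.

(** The nonzero triples (0,a,b) are sorted by which of a and b vanish. *)
Lemma neighbours_e :
  neighbours e = setFK :|: ([set vtxF a | a in [set~ 0]] :|: setK).
Proof.
apply/setP=> x; rewrite in_neighbours adj_eE !in_setU.
apply/idP/or3P; last first.
  case=> [/adj_e_setFK|/imsetP[a]|/adj_e_setK]; rewrite ?adj_eE //.
  by rewrite in_setC1 => a0 ->; rewrite coords_vtxF.
have x0 := coords_neq0 x.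
have vtxE := coordsK x.
move: x0 vtxE; rewrite Z2FK_eq0; case: (coords x) => [[z a] b] /= + + z0.
rewrite z0 /= (eqP z0).
have [-> /= b0 <-|a0 _] := eqVneq a 0.
  by constructor 3; apply/imsetP; exists b; rewrite ?inE.
have [-> <-|b0 <-] := eqVneq b 0.
  by constructor 2; apply/imsetP; exists a; rewrite ?inE.
by constructor 1; apply/imsetP; exists (a, b); rewrite ?inE ?a0.
Qed.

(** The count at [e] only calls for an upper bound, so the union bound suffices. *)
Lemma card_neighbours_e :
  (#|neighbours e| <= #|F|.-1 * #|K|.-1 + #|F|.-1 + #|K|.-1)%N.
Proof.
rewrite neighbours_e -addnA -card_setFK -{1}card_setK.
apply: leq_trans (leq_card_setU _ _) _; rewrite leq_add2l.
apply: leq_trans (leq_card_setU _ _) _; rewrite leq_add2r.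
by rewrite -(cardsC1 (0 : F)) leq_imset_card.
Qed.

Definition v110 : G := vtx (1, 1, 0).

Lemma neighbours_v110 : neighbours v110 = setK.
Proof.
have coords_v : coords v110 = (1, 1, 0).
  by apply: coords_vtx; rewrite ?Z2FK_eq0 //= eqxx !orbT.
apply/setP=> x; rewrite in_neighbours adjE -(inj_eq (can_inj coordsK)).
rewrite coords_v Z2FK_mul_eq0 /= oner_eq0 eqxx /= andbT.
apply/idP/imsetP => [/and3P[_ x1 x2]|[b]]; last first.
  by rewrite !inE => b0 ->; rewrite coords_vtxK //= !eqxx.
have x0 := coords_neq0 x.
have vtxE := coordsK x.
move: x0 vtxE x1 x2; rewrite Z2FK_eq0; case: (coords x) => [[z a] b] /= + + z0 a0.
rewrite z0 a0 (eqP z0) (eqP a0) /= => b0 <-.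
by exists b; rewrite ?inE.
Qed.

(** * Two disjoint blocks cannot coexist *)

Section Blocks.
Local Open Scope nat_scope.
Hypotheses (hF : 3 <= #|F|) (hK : 3 <= #|K|).
Variables S T : {set G}.
Hypotheses (gdaS : global_defensive_alliance S).
Hypotheses (gdaT : global_defensive_alliance T).
Hypotheses (eS : e \in S) (disST : [disjoint S & T]).

(** Outside [T], such a vertex would have to be dominated by [e], which lies in [S]. *)
Lemma setFK_notin_block (x : G) : x \in setFK -> x \notin S.
Proof.
move=> xFK; have [xT|xT] := boolP (x \in T).
  by rewrite (disjointFl disST xT).
have [y yT xy] := gda_dominates gdaT xT.
by rewrite (adj_setFK xFK xy) (disjointFr disST eS) in yT.
Qed.

Lemma setK_sub_block : setK \subset S.
Proof.
apply/subsetP=> w wK; apply: contraT => wS.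
have sub : w |: setFK \subset ~: S :&: neighbours e.
  apply/subsetP=> x /setU1P[->|xFK]; rewrite in_setI in_setC in_neighbours.
    by rewrite wS adj_e_setK.
  by rewrite setFK_notin_block // adj_e_setFK.
have := subset_leq_card sub.
rewrite cardsU1 card_setFK (disjointFl disjoint_setFK_setK wK) /=.
have := gda_defends gdaS eS; rewrite /deg_in.
have := card_neighbours_e; rewrite -(cardsID S (neighbours e)).
rewrite setDE ![neighbours e :&: _]setIC.
(* With f = |F|-1 and k = |K|-1, both at least 2, this is (f-1)(k-1) >= 1. *)
have : #|F|.-1 + #|K|.-1 <= #|F|.-1 * #|K|.-1.
  by case: #|F| #|K| hF hK => [|m] [|n] //=; nia.
move: (#|F|.-1 * #|K|.-1) (#|F|.-1) (#|K|.-1) => fk f k.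
(* Here t >= fk+1 by [sub] and t <= s+1 by defence, so s+t >= 2fk+1, whereas s+t <= fk+f+k <=
   2fk. *)
move: #|S :&: _| #|~: S :&: _| => s t; lia.
Qed.

Lemma blocks_absurd : False.
Proof.
have TK x : x \in setK -> x \notin T.
  by move/(subsetP setK_sub_block)/(disjointFr disST) => ->.
have vT : v110 \in T.
  apply: contraT => /(gda_dominates gdaT)[y yT vy].
  by have := TK y; rewrite -neighbours_v110 in_neighbours vy yT => /(_ isT).
have := gda_defends gdaT vT; rewrite /deg_in neighbours_v110.
have -> : T :&: setK = set0.
  by apply/setP=> x; rewrite in_setI in_set0; apply/andP=> -[xT /TK/negP].
have -> : ~: T :&: setK = setK.
  by apply/setIidPr/subsetP=> x /TK; rewrite in_setC.
(* Defence would now read |K|-1 <= 0+1, against |K| >= 3. *)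
rewrite cards0 card_setK; lia.
Qed.

End Blocks.
End AbstractGraph.
End Z2FK.

Theorem theorem3p17 (F K : finFieldType) (hF : 3 <= #|F|) (hK : 3 <= #|K|) :
  ~ partitionable_gda (zero_divisor_graph ('Z_2 * F * K)%type).
Proof.
pose R : finComNzRingType := ('Z_2 * F * K)%type.
pose V := {x : R | (x != 0%R) && zero_divisor x}.
have v0P : ((1, 0, 0)%R != 0%R :> R) && zero_divisor ((1, 0, 0)%R : R).
  by apply: Z2FK_is_vertex; rewrite ?Z2FK_eq0 /= ?eqxx.
(* The vertex (1,0,0) is the default value of [insubd], taken at triples that are not vertices. *)
pose vtx (x : R) : V := insubd (exist _ (1, 0, 0)%R v0P : V) x.
pose coords (v : V) : R := val v.
have coordsK : cancel coords vtx by exact: valKd.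
have coords_neq0 v : coords v != 0%R by case/andP: (valP v).
have coords_vtx (x : R) : x != 0%R ->
    [|| x.1.1 == 0%R, x.1.2 == 0%R | x.2 == 0%R] -> coords (vtx x) = x.
  by move=> x0 xz; apply: insubdK; apply: Z2FK_is_vertex.
pose e0 : zero_divisor_graph R := vtx (1, 0, 0)%R.
case/(partitionable_gdaP e0) => S [T [eS disST gdaS gdaT]].
(* The adjacency hypothesis [adjE] holds by conversion, hence [erefl]. *)
exact: (@blocks_absurd F K (zero_divisor_graph R) coords vtx coordsK
  coords_neq0 coords_vtx (fun _ _ => erefl) hF hK S T gdaS gdaT eS disST).
Qed.
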